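(* Let $\mu$ be a finite (possibly signed) Borel measure on $\mathbb{R}^d$. Then $\mu\ll\mathscr{L}^d$ if and only if $$\liminf_{\lambda\to+\infty}\lambda\,\mathscr{L}^d\big(\{x\in\mathbb{R}^d : \overline{\mathsf{M}}\mu(x)>\lambda\}\big)=0.$$
   Context: $\mathscr{L}^d$ is the Lebesgue measure on $\mathbb{R}^d$ and $B(x,r)$ is the ball of center $x$ and radius $r$. For a finite (possibly signed) Borel measure $\mu$ on $\mathbb{R}^d$ and $x\in\mathbb{R}^d$, define $$\overline{\mathsf{M}}\mu(x):=\sup_{r>0}\frac{|\mu(B(x,r))|}{\mathscr{L}^d(B(x,r))}\in[0,+\infty],$$ where $|\mu(B(x,r))|$ is the absolute value of the number $\mu(B(x,r))$. The notation $\mu\ll\mathscr{L}^d$ means that $\mu$ is absolutely continuous with respect to $\mathscr{L}^d$. *)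

(* Defs.v *)
From HB Require Import structures.
From mathcomp Require Import all_boot all_order all_algebra.
From mathcomp Require Import all_classical all_reals all_analysis.
From mathcomp Require Import measurable_realfun.

Set Implicit Arguments.
Unset Strict Implicit.
Unset Printing Implicit Defensive.

Import Order.TTheory GRing.Theory Num.Theory.
Import numFieldNormedType.Exports.

Local Open Scope classical_set_scope.
Local Open Scope ring_scope.

(* The Borel sigma-algebra of R^d, generated by the open sets. The topology of
   'rV[R]_d is that of the sup norm, hence also that of the Euclidean norm. *)
Notation borelRV R d := (g_sigma_algebraType (@open 'rV[R]_d)).

Definition cons_rV (R : realType) (d : nat) (p : R * borelRV R d) :
  borelRV R d.+1 := row_mx p.1%:M p.2.

(* Lebesgue measure as an iterated product: the Dirac mass on R^0, and the image
   of L^1 \x L^d under the identification of R * R^d with R^(d+1). As a set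
   function it is defined on all subsets, but it is only meaningful on Borel
   sets, where it is a sigma-finite measure giving mass (2e)^d to every cube
   of side 2e. *)
Fixpoint lebesgue_rV (R : realType) (d : nat) : set (borelRV R d) -> \bar R :=
  match d return set (borelRV R d) -> \bar R with
  | 0 => @dirac _ (borelRV R 0) (0 : 'rV[R]_0) R
  | d'.+1 => pushforward (lebesgue_measure \x @lebesgue_rV R d')%E
               (@cons_rV R d')
  end.
Arguments lebesgue_rV : clear implicits.

Lemma open_measurable_rV (R : realType) (d : nat) (U : set 'rV[R]_d) :
  open U -> measurable (U : set (borelRV R d)).
Proof. exact: sub_sigma_algebra. Qed.

Lemma preimage_cons_rV_ball (R : realType) (d : nat) (x : 'rV[R]_(1 + d)) (e : R) :
  0 < e ->
  @cons_rV R d @^-1` (ball x e : set 'rV[R]_(1 + d)) =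
  (ball (x 0 0) e : set R) `*` (ball (rsubmx x : 'rV[R]_d) e).
Proof.
move=> e0; apply/seteqP; split => [[t v] /= [_ h]|[t v] /= [h1 [_ h2]]].
  split.
    have := h 0 (lshift d 0).
    rewrite /cons_rV /= row_mxEl mxE eqxx mulr1n.
    by have -> : lshift d 0 = 0 :> 'I_(1 + d) by exact/val_inj.
  by split => // i j; have := h i (rshift 1 j); rewrite /cons_rV /= row_mxEr mxE.
split => // i j; rewrite /cons_rV /=.
rewrite ord1; case: (splitP j) => k jk.
  have -> : j = lshift d k by exact/val_inj.
  rewrite row_mxEl ord1 mxE eqxx mulr1n.
  by have -> : lshift d 0 = 0 :> 'I_(1 + d) by exact/val_inj.
have -> : j = rshift 1 k by exact/val_inj.
by rewrite row_mxEr; have := h2 0 k; rewrite mxE.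
Qed.

Lemma measurable_cons_rV (R : realType) (d : nat) :
  measurable_fun [set: R * borelRV R d] (@cons_rV R d).
Proof.
apply: (@measurability _ _ (R * borelRV R d)%type (borelRV R d.+1) setT _ (@open 'rV[R]_d.+1)) => //.
move=> _ [U oU <-]; rewrite setTI.
pose q (z : 'rV[rat]_d.+1) : 'rV[R]_d.+1 := map_mx ratr z.
pose V (zn : 'rV[rat]_d.+1 * nat) : set 'rV[R]_d.+1 := ball (q zn.1) (zn.2.+1%:R^-1).
have -> : U = \bigcup_(zn in [set zn | V zn `<=` U]) V zn.
  apply/seteqP; split => [x Ux|x [zn /= VU Vx]]; last exact: VU.
  have /nbhs_ballP[e /= e0 xeU] : nbhs x U by exact: open_nbhs_nbhs.
  have [n ne] : exists n : nat, n.+1%:R^-1 < e / 2.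
    have e20 : 0 < e / 2 by rewrite divr_gt0.
    exists (Num.truncn (e / 2)^-1).
    by rewrite invf_plt ?posrE// Num.Theory.truncnS_gt.
  have n0 : 0 < n.+1%:R^-1 :> R by rewrite invr_gt0.
  have hz i : exists z : rat, ball (x 0 i) n.+1%:R^-1 (ratr z : R).
    have [|z] := @rat_in_itvoo R (x 0 i - n.+1%:R^-1) (x 0 i + n.+1%:R^-1).
      by rewrite ltrBlDr -addrA ltrDl addr_gt0.
    by move=> zi; exists z; rewrite ball_itv.
  have [z hz'] := choice hz.
  have qx : ball x n.+1%:R^-1 (q (\row_i z i)).
    by split => // i j; rewrite ord1 !mxE.
  exists (\row_i z i, n) => /=; last exact: ball_sym.
  move=> y qy; apply: xeU; rewrite (splitr e).
  apply: (@ball_triangle _ _ (q (\row_i z i))).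
    exact: (le_ball (ltW ne)) qx.
  exact: (le_ball (ltW ne)) qy.
rewrite preimage_bigcup bigcup_mkcond.
apply: countable_bigcupT_measurable; first exact: countableP.
move=> zn; case: ifPn => _ //.
rewrite preimage_cons_rV_ball ?invr_gt0//.
apply: measurableX; first exact: measurable_ball.
by apply: open_measurable_rV; exact: ball_open.
Qed.

Lemma lebesgue_rV_subproof (R : realType) (d : nat) :
  (exists m : {sigma_finite_measure set (borelRV R d) -> \bar R},
    m = lebesgue_rV R d :> (set _ -> \bar R)) /\
  (forall (x : 'rV[R]_d) (e : R), 0 < e ->
    lebesgue_rV R d (ball x e) = ((e *+ 2) ^+ d)%:E).
Proof.
elim: d => [|d [[m mE] IH]].
  split; first by exists (@dirac _ (borelRV R 0) (0 : 'rV[R]_0) R).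
  move=> x e e0 /=; rewrite expr0 diracE mem_set//=.
  by split => // i [].
have mcons := @measurable_cons_rV R d.
have cube (x : 'rV[R]_d.+1) (e : R) : 0 < e ->
    lebesgue_rV R d.+1 (ball x e) = ((e *+ 2) ^+ d.+1)%:E.
  move=> e0; rewrite /= /pushforward preimage_cons_rV_ball// -mE.
  rewrite product_measure1E; last 2 first.
  - exact: measurable_ball.
  - by apply: open_measurable_rV; exact: ball_open.
  rewrite /= mE IH// lebesgue_measure_ball ?ltW// -EFinM exprS.
  by [].
split => //.
pose p := measure_function_pushforward__canonical__measure_function_Measure
  (lebesgue_measure \x m)%E mcons.
have pE : p = lebesgue_rV R d.+1 :> (set _ -> \bar R) by rewrite /= -mE.
have psf : sigma_finite setT (p : set (borelRV R d.+1) -> \bar R).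
  exists (fun n => ball (0 : 'rV[R]_d.+1) n.+1%:R).
    apply/seteqP; split => // x _.
    exists (Num.truncn `|x|) => //=.
    by rewrite -ball_normE /= sub0r normrN Num.Theory.truncnS_gt.
  move=> n; split; first by apply: open_measurable_rV; exact: ball_open.
  by rewrite pE cube// ltry.
pose q := HB.pack_for {sigma_finite_measure set (borelRV R d.+1) -> \bar R}
  (p : set _ -> _) p (@Measure_isSigmaFinite.Build _ _ _ p psf).
by exists q.
Qed.

Lemma lebesgue_rV_cube (R : realType) (d : nat) (x : 'rV[R]_d) (e : R) :
  0 < e -> lebesgue_rV R d (ball x e) = ((e *+ 2) ^+ d)%:E.
Proof. exact: (lebesgue_rV_subproof R d).2. Qed.

Section lebesgue_rV_measure.
Variables (R : realType) (d : nat).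

Let lebesgue_rV0 : lebesgue_rV R d set0 = 0%E.
Proof. by have [[m <-] _] := lebesgue_rV_subproof R d; exact: measure0. Qed.

Let lebesgue_rV_ge0 A : (0 <= lebesgue_rV R d A)%E.
Proof. by have [[m <-] _] := lebesgue_rV_subproof R d; exact: measure_ge0. Qed.

Let lebesgue_rV_sigma_additive : semi_sigma_additive (lebesgue_rV R d).
Proof.
have [[m <-] _] := lebesgue_rV_subproof R d.
exact: measure_semi_sigma_additive.
Qed.

HB.instance Definition _ := isMeasure.Build _ _ _ (lebesgue_rV R d)
  lebesgue_rV0 lebesgue_rV_ge0 lebesgue_rV_sigma_additive.

Let lebesgue_rV_sigma_finite : sigma_finite setT (lebesgue_rV R d).
Proof. by have [[m <-] _] := lebesgue_rV_subproof R d; exact: sigma_finiteT. Qed.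

HB.instance Definition _ := Measure_isSigmaFinite.Build _ _ _ (lebesgue_rV R d)
  lebesgue_rV_sigma_finite.

End lebesgue_rV_measure.

Definition norm2 (R : realType) (d : nat) (x : 'rV[R]_d) : R :=
  Num.sqrt (\sum_(i < d) x 0 i ^+ 2).

(* The library's [ball] on 'rV[R]_d is a sup-norm cube, so the Euclidean ball
   B(x, r) is defined separately. *)
Definition eball (R : realType) (d : nat) (x : 'rV[R]_d) (r : R) :
  set 'rV[R]_d := [set y | norm2 (y - x) < r].

(* The absolute value is that of the number mu (B(x, r)), not the total
   variation. *)
Definition maximal (R : realType) (d : nat)
    (mu : {charge set (borelRV R d) -> \bar R}) (x : 'rV[R]_d) : \bar R :=
  ereal_sup [set (`|mu (eball x r)| / lebesgue_rV R d (eball x r))%E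
            | r in `]0, +oo[%classic].

(* Main.v *)
(* Write |mu| for the total variation and M mu for the maximal function, which
   only sees the numbers |mu (B(x, r))|.

   If mu << L, then a Vitali covering of a compact subset K of {M mu > a} by
   balls with |mu (B)| > a L(B) yields a set W, the union of disjoint ones,
   with L(K) <= C L(W) and a L(W) <= |mu|(W).  Hence L(W) is small for large a,
   so |mu|(W) is small by absolute continuity, and so is a L(K).

   Conversely, let p and n be the two Jordan parts of mu, in either order, and
   suppose that p charges an L-null set on which n vanishes.  By a Vitali
   argument p charges a compact K in this set such that n(B(x, r)) <=
   tau p(B(x, 6 r)) for x in K and all small r.  Let E = {M mu > a}
   and let U be a neighbourhood of K with a L(U) small.  Every x in K has a
   radius rho such that B(x, rho) lies in E `|` U while B(x, 2 rho) meets the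
   complement of E.  Comparing with a ball centred at a point y outside E,
   where p(B(y, s)) <= a L(B(y, s)) + n(B(y, s)), gives
     p(B(x, s)) <= C a s^d + tau p(B(x, q s))    for all s >= rho,
   and as tau q^d < 1 this iterates to p(B(x, rho)) <= C' a rho^d.  A last
   Vitali covering of K bounds p(K) by C'' a L(E `|` U), which is arbitrarily
   small for suitable a. *)

Require Import Defs.
From mathcomp Require Import all_boot all_order all_algebra.
From mathcomp Require Import all_classical all_reals all_analysis.
From mathcomp Require Import measurable_realfun ring lra.

Set Implicit Arguments.
Unset Strict Implicit.
Unset Printing Implicit Defensive.

Import Order.TTheory GRing.Theory Num.Theory.
Import numFieldNormedType.Exports.

Local Open Scope classical_set_scope.
Local Open Scope ring_scope.

(** * The Vitali covering lemma *)

(** Greedy choice: keep a ball of largest radius, discard every ball meeting it, and recurse on the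
    rest. A discarded ball meets a kept one of at least its own radius, so tripling the kept ball
    covers it. *)
Lemma vitali_finite (R : realType) (V : normedModType R) (r : V -> R)
    (s : seq V) :
  exists t : seq V, [/\ uniq t, {subset t <= s},
    trivIset [set` t] (fun x => ball x (r x)) &
    forall x, x \in s -> exists2 y, y \in t &
      ball x (r x) `<=` ball y (3 * r y)].
Proof.
(* The order on radii is reversed: the head of a sorted list has the largest radius. *)
pose LE x y := r y <= r x.
have LEtr : transitive LE by move=> x y z xy yz; exact: le_trans yz xy.
have LEtot : total LE by move=> x y; exact: le_total.
elim: {s}(size s) {-2}s (leqnn (size s)) => [|n IH] s sn.
  exists [::]; split => //.
  by move: sn; rewrite leqn0 size_eq0 => /eqP ->.
have [s0|s0] := boolP (s == [::]).
  by exists [::]; split => //; rewrite (eqP s0).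
have /hasP[x xs xmax] : has (fun x => all (LE x) s) s.
  have : sorted LE (sort LE s) by exact: sort_sorted.
  case E : (sort LE s) => [|y l].
    by move: (size_sort LE s); rewrite E => /esym/eqP; rewrite size_eq0 (negbTE s0).
  move=> yl; apply/hasP; exists y; first by rewrite -(mem_sort LE) E mem_head.
  rewrite -(all_sort _ LE) E /= /LE lexx /=.
  exact: (order_path_min LEtr yl).
(* An empty ball is disjoint from itself, so [y != x] is what makes [s'] shorter than [s] when
   [r x <= 0]. *)
pose s' := [seq y <- s | `[< ball y (r y) `&` ball x (r x) = set0 >]
                           && (y != x)].
have [|t [ut ts tt tc]] := IH s'.
  rewrite -ltnS (leq_trans _ sn)// size_filter ltn_neqAle count_size andbT.
  by rewrite -all_count; apply/allPn; exists x => //; rewrite eqxx andbF.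
exists (x :: t); split.
- rewrite /= ut andbT; apply/negP => /ts.
  by rewrite mem_filter eqxx andbF.
- move=> y; rewrite inE => /predU1P[->//|/ts].
  by rewrite mem_filter => /andP[].
- have disj y : y \in t -> ball y (r y) `&` ball x (r x) = set0.
    by move=> /ts; rewrite mem_filter => /andP[/andP[/asboolP]].
  move=> a b /=; rewrite !inE => /predU1P[->|at_] /predU1P[->|bt] //.
  + by rewrite setIC disj// => /set0P; rewrite eqxx.
  + by rewrite disj// => /set0P; rewrite eqxx.
  + exact: tt.
- move=> y ys; have rxy : r y <= r x by move/allP : xmax => /(_ _ ys).
  have [yI|yI] := pselect (ball y (r y) `&` ball x (r x) = set0 /\ y != x).
    have [|z zt yz] := tc y.
      by rewrite mem_filter ys andbT; apply/andP; split; [apply/asboolP|]; case: yI.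
    by exists z => //; rewrite inE zt orbT.
  exists x; first by rewrite mem_head.
  have [->|yx] := eqVneq y x.
    move=> z zx; apply: (le_ball _ zx); rewrite ler_peMl//; last by rewrite ler1n.
    by move: zx; rewrite -ball_normE /= => /(le_lt_trans (normr_ge0 _))/ltW.
  have /set0P[z [yz xz]] : ball y (r y) `&` ball x (r x) != set0.
    by apply/eqP => e0; exact: yI.
  move=> w yw; rewrite (_ : 3 * r x = r x + r x + r x); last by ring.
  apply: (@ball_triangle _ _ y); last exact: le_ball yw.
  apply: (@ball_triangle _ _ z) => //; apply: ball_sym.
  exact: le_ball yz.
Qed.

Lemma compact_vitali (R : realType) (V : normedModType R) (K : set V)
    (r : V -> R) :
  compact K -> (forall x, K x -> 0 < r x) ->
  exists t : seq V, [/\ uniq t, (forall x, x \in t -> K x),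
    trivIset [set` t] (fun x => ball x (r x)) &
    K `<=` \big[setU/set0]_(x <- t) ball x (3 * r x)].
Proof.
rewrite compact_cover => cK r0.
have [||D DK KD] := cK V K (fun x => ball x (r x)).
- by move=> x _; exact: ball_open.
- by move=> x Kx; exists x => //; exact/ballxx/r0.
have [t [ut ts tt tc]] := vitali_finite r (finmap.enum_fset D).
exists t; split => // [x /ts xD|x /KD[y yD]].
  by have := DK x xD; rewrite inE.
move=> xy; have [z zt yz] := tc y yD.
by rewrite -bigcup_seq; exists z => //; exact: yz.
Qed.

(** * Euclidean balls against sup-norm cubes *)

Lemma normrV_le_norm2 (R : realType) (d : nat) (x : 'rV[R]_d) :
  `|x| <= norm2 x.
Proof.
rewrite [leLHS]/Num.norm /= mx_normrE; apply: bigmax_le; first exact: sqrtr_ge0.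
move=> [i j] _ /=; rewrite ord1 -sqrtr_sqr ler_wsqrtr//.
by rewrite (bigD1 j)//= lerDl sumr_ge0// => k _; exact: sqr_ge0.
Qed.

Lemma coord_le_normrV (R : realType) (d : nat) (x : 'rV[R]_d) (i : 'I_d) :
  `|x 0 i| <= `|x|.
Proof.
rewrite [leRHS]/Num.norm /= mx_normrE.
by apply/bigmax_geP; right => /=; exists (0, i).
Qed.

(* A surrogate for the triangle inequality whose error term is measured in
   the sup norm; it spares us the Cauchy-Schwarz inequality. *)
Lemma norm2D_le (R : realType) (d : nat) (u v : 'rV[R]_d) :
  norm2 (u + v) <= norm2 u + d%:R * `|v|.
Proof.
have nu0 : 0 <= norm2 u by exact: sqrtr_ge0.
have v0 : 0 <= d%:R * `|v| by rewrite mulr_ge0.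
rewrite -(@ler_pXn2r _ 2) ?nnegrE ?addr_ge0 ?sqrtr_ge0//.
rewrite sqr_sqrtr ?sumr_ge0// => [|i _]; last exact: sqr_ge0.
have s0 : 0 <= \sum_(i < d) u 0 i ^+ 2.
  by apply: sumr_ge0 => i _; exact: sqr_ge0.
have -> : (norm2 u + d%:R * `|v|) ^+ 2 = \sum_(i < d) u 0 i ^+ 2
    + (2 * d%:R * norm2 u * `|v| + d%:R ^+ 2 * `|v| ^+ 2).
  by rewrite sqrrD sqr_sqrtr// -addrA; congr (_ + _); rewrite exprMn; ring.
rewrite (eq_bigr (fun i => u 0 i ^+ 2 + (2 * (u 0 i * v 0 i) + v 0 i ^+ 2)));
  last by move=> i _; rewrite !mxE; ring.
rewrite big_split /= lerD2l big_split /= lerD//.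
- rewrite (_ : 2 * _ * _ * _ = \sum_(i < d) (2 * (norm2 u * `|v|))); last first.
    by rewrite sumr_const card_ord -mulr_natl; ring.
  apply: ler_sum => i _; rewrite ler_pM2l//.
  rewrite (le_trans (ler_norm _))// normrM ler_pM//.
  + exact: le_trans (coord_le_normrV u i) (normrV_le_norm2 u).
  + exact: coord_le_normrV.
- apply: (@le_trans _ _ (\sum_(i < d) `|v| ^+ 2)).
    apply: ler_sum => i _; rewrite -[leLHS]ger0_norm ?sqr_ge0// normrX.
    by rewrite lerXn2r ?nnegrE// coord_le_normrV.
  rewrite sumr_const card_ord -[_ *+ _]mulr_natl ler_wpM2r ?exprn_ge0//.
  by rewrite -natrX ler_nat; case: (d) => // k; rewrite -mulnn leq_pmulr.
Qed.

Lemma eball_sub_ball (R : realType) (d : nat) (x : 'rV[R]_d) (r : R) :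
  eball x r `<=` ball x r.
Proof.
move=> y; rewrite /eball /= => yx; rewrite -ball_normE /= distrC.
exact: le_lt_trans (normrV_le_norm2 _) yx.
Qed.

Lemma eball_sub_eball (R : realType) (d : nat) (x y : 'rV[R]_d) (r s : R) :
  s + d%:R * `|x - y| <= r -> eball y s `<=` eball x r.
Proof.
move=> sr z; rewrite /eball /= => zy; apply: lt_le_trans sr.
rewrite (_ : z - x = (z - y) + (y - x)); last by rewrite subrKA.
by rewrite (le_lt_trans (norm2D_le _ _))// distrC ltrD2r.
Qed.

(** The factor is [d.+1] rather than [d] so that it can be divided by in dimension 0 as well. *)
Lemma ball_sub_eball (R : realType) (d : nat) (x y : 'rV[R]_d) (r s : R) :
  norm2 (y - x) + d.+1%:R * s <= r -> ball y s `<=` eball x r.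
Proof.
move=> sr z; rewrite -ball_normE /= distrC => zy.
rewrite /eball /= (_ : z - x = (y - x) + (z - y)); last first.
  by rewrite [RHS]addrC subrKA.
apply: lt_le_trans sr; rewrite (le_lt_trans (norm2D_le _ _))// ltrD2l.
have s0 : 0 < s by exact: le_lt_trans zy.
apply: (@le_lt_trans _ _ (d%:R * s)); first by rewrite ler_wpM2l// ltW.
by rewrite ltr_pM2r// ltr_nat.
Qed.

Lemma eball_open (R : realType) (d : nat) (x : 'rV[R]_d) (r : R) :
  open (eball x r).
Proof.
rewrite openE => y; rewrite /eball /= => yx.
apply/nbhs_ballP; exists ((r - norm2 (y - x)) / d.+1%:R) => /=.
  by rewrite divr_gt0// subr_gt0.
by apply: ball_sub_eball; rewrite mulrC divfK ?pnatr_eq0// addrC subrK.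
Qed.

Lemma measurable_eball (R : realType) (d : nat) (x : 'rV[R]_d) (r : R) :
  measurable (eball x r : set (borelRV R d)).
Proof. by apply: open_measurable_rV; exact: eball_open. Qed.

Lemma measurable_ballrV (R : realType) (d : nat) (x : 'rV[R]_d) (r : R) :
  measurable (ball x r : set (borelRV R d)).
Proof. by apply: open_measurable_rV; exact: ball_open. Qed.

(** With [lebesgue_eball_ge], this stands in for the exact volume of a Euclidean ball: the covering
    arguments only use its order [r ^+ d]. *)
Lemma lebesgue_eball_le (R : realType) (d : nat) (x : 'rV[R]_d) (r : R) :
  0 < r -> (lebesgue_rV R d (eball x r) <= ((r *+ 2) ^+ d)%:E)%E.
Proof.
move=> r0; rewrite -(lebesgue_rV_cube x)// le_measure ?inE//.
- exact: measurable_eball.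
- exact: measurable_ballrV.
- exact: eball_sub_ball.
Qed.

Lemma lebesgue_eball_ge (R : realType) (d : nat) (x : 'rV[R]_d) (r : R) :
  0 < r -> (((r / d.+1%:R *+ 2) ^+ d)%:E <= lebesgue_rV R d (eball x r))%E.
Proof.
move=> r0; rewrite -(lebesgue_rV_cube x) ?divr_gt0// le_measure ?inE//.
- exact: measurable_ballrV.
- exact: measurable_eball.
- apply: ball_sub_eball; rewrite subrr [norm2 _](_ : _ = 0); last first.
    by rewrite /norm2 big1 ?sqrtr0// => i _; rewrite mxE expr0n.
  by rewrite add0r mulrC divfK ?pnatr_eq0.
Qed.

(** * Continuity from above and regularity of Borel measures *)

Lemma measure_nonincreasing_lt d (T : measurableType d) (R : realType)
    (m : {measure set T -> \bar R}) (F : nat -> set T) (e : R) :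
  (forall n, measurable (F n)) -> nonincreasing_seq F ->
  (m (F 0%N) < +oo)%E -> m (\bigcap_n F n) = 0%E -> 0 < e ->
  exists n, (m (F n) < e%:E)%E.
Proof.
move=> mF ndF F0 m0 e0; apply/not_existsP => H.
have mcap : measurable (\bigcap_n F n) by exact: bigcap_measurableType.
have cv := nonincreasing_cvg_mu F0 mF mcap ndF.
have : (e%:E <= lim ((m \o F) n @[n --> \oo]))%E.
  apply: lime_ge; first by apply/cvg_ex; eexists; exact: cv.
  by apply: nearW => n /=; rewrite leNgt; apply/negP; exact: H.
by move/cvg_lim : cv => -> //; rewrite m0 lee_fin leNgt e0.
Qed.

Lemma open_compact_exhaustion (R : realType) (d : nat) (U : set 'rV[R]_d) :
  open U -> exists F : nat -> set 'rV[R]_d,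
    [/\ (forall n, compact (F n)), nondecreasing_seq F & \bigcup_n F n = U].
Proof.
move=> oU.
(* An open neighbourhood of the points to be avoided, those outside [U] or of norm above [n]; its
   complement is closed and bounded. *)
pose B n := \bigcup_(z in ~` U `|` [set z | n%:R < `|z|])
  ball z n.+1%:R^-1 : set 'rV[R]_d.
have xB n z : (~` U `|` [set z | n%:R < `|z|]) z -> B n z.
  by move=> zB; exists z => //; apply: ballxx; rewrite invr_gt0.
exists (fun n => ~` B n); split.
- move=> n; apply: bounded_closed_compact; last first.
    rewrite closedC; apply: bigcup_open => z _; exact: ball_open.
  exists n%:R; split; first exact: num_real.
  move=> r nr x /= xB'; rewrite leNgt; apply/negP => rx; apply: xB'.
  by apply: xB; right => /=; exact: lt_trans rx.
- move=> n k nk; apply/subsetPset; apply: subsetC => x [z zB xz].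
  exists z; last first.
    by apply: le_ball xz; rewrite lef_pV2 ?posrE// ler_nat ltnS.
  case: zB => [|/= zk]; [by left|right => /=].
  by apply: le_lt_trans zk; rewrite ler_nat.
- apply/seteqP; split => [x [n _ xB']|x Ux].
    by apply: contrapT => Ux; apply: xB'; apply: xB; left.
  have /nbhs_ballP[e /= e0 xeU] : nbhs x U by exact: open_nbhs_nbhs.
  (* The margin 1 in [|x| + 1 < n] absorbs the radius [n.+1%:R^-1 <= 1], so no centre of norm above
     [n] is that close to [x]. *)
  pose n := (Num.truncn (`|x| + 1) + Num.truncn e^-1).+1.
  have nx : `|x| + 1 < n%:R.
    by apply: lt_le_trans (truncnS_gt _) _; rewrite ler_nat ltnS leq_addr.
  have ne : n.+1%:R^-1 < e.
    rewrite invf_plt ?posrE//; apply: lt_le_trans (truncnS_gt _) _.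
    by rewrite ler_nat ltnS leqW// leq_addl.
  exists n => // -[z [zU|/= nz]] zx.
    apply: zU; apply: xeU; apply: ball_sym; exact: le_ball (ltW ne) _ zx.
  move: zx; rewrite -ball_normE /= => zx.
  have : `|z| < n%:R.
    rewrite -(subrK x z) (le_lt_trans (ler_normD _ _))//.
    apply: lt_trans nx; rewrite addrC ltrD2l (lt_le_trans zx)//.
    by rewrite invf_le1 ?ler1n.
  by rewrite ltNge (ltW nz).
Qed.

Lemma compact_measurable_rV (R : realType) (d : nat) (K : set 'rV[R]_d) :
  compact K -> measurable (K : set (borelRV R d)).
Proof.
move=> cK; rewrite -[K]setCK; apply: measurableC; apply: open_measurable_rV.
by rewrite openC; apply: compact_closed => //; exact: norm_hausdorff.
Qed.

Lemma measure_bigcup_le d (T : measurableType d) (R : realType)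
    (m : {measure set T -> \bar R}) (F : nat -> set T) (c : \bar R) :
  (forall n, measurable (F n)) -> nondecreasing_seq F ->
  (forall n, (m (F n) <= c)%E) -> (m (\bigcup_n F n) <= c)%E.
Proof.
move=> mF ndF Fc.
have cv := @nondecreasing_cvg_mu _ _ _ m F mF (bigcupT_measurable F mF) ndF.
move/cvg_lim : (cv) => <- //; apply: lime_le.
  by apply/cvg_ex; eexists; exact: cv.
exact: nearW.
Qed.

(** Inner regularity on open sets, by exhaustion. It serves to bound the Lebesgue measure of
    superlevel sets through their compact subsets. *)
Lemma measure_open_le_compact (R : realType) (d : nat)
    (m : {measure set (borelRV R d) -> \bar R}) (U : set 'rV[R]_d) (c : \bar R) :
  open U -> (forall K : set 'rV[R]_d, compact K -> K `<=` U -> (m K <= c)%E) ->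
  (m U <= c)%E.
Proof.
move=> oU Kc; have [F [cF ndF FU]] := open_compact_exhaustion oU.
rewrite -FU; apply: measure_bigcup_le => // n.
  exact: compact_measurable_rV.
by apply: Kc => //; rewrite -FU; exact: bigcup_sup.
Qed.

(** The sets with this approximation property form a sigma-algebra containing the open sets. *)
Lemma finite_measure_closed_open (R : realType) (d : nat)
    (m : {finite_measure set (borelRV R d) -> \bar R})
    (A : set (borelRV R d)) (e : R) : measurable A -> 0 < e ->
  exists C U : set 'rV[R]_d,
    [/\ closed C, open U, C `<=` A, A `<=` U & (m (U `\` C) < e%:E)%E].
Proof.
move=> mA; move: e.
have mfin (B : set (borelRV R d)) : measurable B -> (m B < +oo)%E.
  by move=> mB; rewrite ltey_eq fin_num_measure.
have mo (B : set 'rV[R]_d) : open B -> measurable (B : set (borelRV R d)).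
  exact: open_measurable_rV.
have mc (B : set 'rV[R]_d) : closed B -> measurable (B : set (borelRV R d)).
  by move=> cB; rewrite -[B]setCK; apply: measurableC; apply: mo; rewrite openC.
suff : (@measurable _ (borelRV R d)) `<=` [set A | forall e : R, 0 < e ->
  exists C U : set 'rV[R]_d,
    [/\ closed C, open U, C `<=` A, A `<=` U & (m (U `\` C) < e%:E)%E]].
  by move=> /(_ _ mA) + e; apply.
apply: smallest_sub; last first.
  move=> U oU e e0; have [F [cF ndF FU]] := open_compact_exhaustion oU.
  have clF n : closed (F n) by apply: compact_closed => //; exact: norm_hausdorff.
  have [|||||n nU] := @measure_nonincreasing_lt _ _ _ m (fun n => U `\` F n) e.
  - by move=> n; apply: measurableD; [exact: mo|exact: mc].
  - move=> n k nk; apply/subsetPset => x [Ux Fk]; split => // Fn.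
    by apply: Fk; move/subsetPset : (ndF _ _ nk); exact.
  - by apply: mfin; apply: measurableD; [exact: mo|exact: mc].
  - rewrite (_ : \bigcap_n _ = set0) ?measure0//.
    apply/seteqP; split => // x xF.
    have [Ux _] := xF 0%N I.
    by move: Ux; rewrite -FU => -[k _ Fkx]; have [_] := xF k I.
  - by [].
  - exists (F n), U; split => //.
    by rewrite -FU; exact: bigcup_sup.
split.
- move=> e e0; exists set0, set0.
  split; [exact: closed0|exact: open0|by []|by []|].
  by rewrite setD0 measure0 lte_fin.
- move=> {mA}A HA e e0; have [C [U [cC oU CA AU UC]]] := HA e e0.
  exists (~` U), (~` C); split; rewrite ?setTD.
  + by rewrite closedC.
  + by rewrite openC.
  + exact: subsetC.
  + exact: subsetC.
  + by rewrite setDE setCK setIC -setDE.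
- move=> {mA}A HA e e0.
  (* A countable union of closed sets need not be closed. Half of [e] pays for the approximations of
     the [A n], with geometric weights; the other half pays for keeping only finitely many of the
     closed sets. *)
  have e20 : 0 < e / 2 by rewrite divr_gt0.
  have H n : exists CU : set 'rV[R]_d * set 'rV[R]_d,
      [/\ closed CU.1, open CU.2, CU.1 `<=` A n, A n `<=` CU.2 &
       (m (CU.2 `\` CU.1) < (e / 2 / (2 ^ n.+1)%:R)%:E)%E].
    have [|C [U CU]] := HA n (e / 2 / (2 ^ n.+1)%:R).
      by rewrite divr_gt0// ltr0n expn_gt0.
    by exists (C, U).
  have {H}[CU H] := choice H.
  pose C k := (CU k).1; pose U k := (CU k).2.
  have cC k : closed (C k) by have [] := H k.
  have oU k : open (U k) by have [] := H k.
  pose V n := \big[setU/set0]_(k < n) C k.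
  have cV n : closed (V n) by apply: closed_bigsetU => k _; exact: cC.
  have mCC : measurable (\bigcup_k C k : set (borelRV R d)).
    by apply: bigcupT_measurable => k; exact: mc.
  have [|||||n Vn] := @measure_nonincreasing_lt _ _ _ m
    (fun n => (\bigcup_k C k) `\` V n) (e / 2).
  + by move=> n; apply: measurableD => //; exact: mc.
  + move=> n k nk; apply/subsetPset; apply: setDS; rewrite /V.
    exact: subset_bigsetU.
  + by apply: mfin; apply: measurableD => //; exact: mc.
  + rewrite (_ : \bigcap_n _ = set0) ?measure0//.
    apply/seteqP; split => // x xF.
    have [[k _ Ck] _] := xF 0%N I.
    have [_] := xF k.+1 I; apply.
    by rewrite /V -bigcup_mkord; exists k => /=.
  + by [].
  + exists (V n), (\bigcup_k U k); split => //.
    * exact: bigcup_open.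
    * rewrite /V -bigcup_mkord => x [k _ Ck]; exists k => //.
      by have [_ _ CA _ _] := H k; exact: CA.
    * by apply: subset_bigcup => k _; have [] := H k.
    * have mD k : measurable (U k `\` C k : set (borelRV R d)).
        by apply: measurableD; [exact: mo|exact: mc].
      have mDD : measurable (\bigcup_k (U k `\` C k) : set (borelRV R d)).
        exact: bigcupT_measurable.
      have mVn : measurable (\bigcup_k C k `\` V n : set (borelRV R d)).
        by apply: measurableD => //; exact: mc.
      apply: (@le_lt_trans _ _
          (m (\bigcup_k (U k `\` C k)) + m (\bigcup_k C k `\` V n)))%E.
        apply: le_trans (measureU2 m mDD mVn).
        rewrite le_measure ?inE//.
        -- by apply: measurableD; [apply: mo; exact: bigcup_open|exact: mc].
        -- exact: measurableU.
        -- move=> x [[k _ Uk] Vx].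
           have [Cx|Cx] := pselect ((\bigcup_k C k) x); first by right.
           by left; exists k => //; split => // Ck; apply: Cx; exists k.
      rewrite [e in (_ < e%:E)%E](splitr e) EFinD lee_ltD ?fin_num_measure//.
      apply: le_trans (epsilon_trick0 xpredT (ltW e20)).
      apply: (@le_trans _ _ (\sum_(k <oo) m (U k `\` C k))%E).
        exact: measure_sigma_subadditive.
      apply: lee_nneseries => // k _.
      by have [_ _ _ _ /ltW] := H k.
Qed.

(** Inner regularity: a closed subset of [A] carries all but [e] of the mass, and it is exhausted by
    its intersections with compact sets filling the space. *)
Lemma finite_measure_le_compact (R : realType) (d : nat)
    (m : {finite_measure set (borelRV R d) -> \bar R})
    (A : set (borelRV R d)) (c : \bar R) :
  measurable A ->
  (forall K : set 'rV[R]_d, compact K -> K `<=` A -> (m K <= c)%E) ->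
  (m A <= c)%E.
Proof.
move=> mA Kc; apply/lee_addgt0Pr => e e0.
have [C [U [cC oU CA AU UCe]]] := finite_measure_closed_open m mA e0.
have mC : measurable (C : set (borelRV R d)).
  rewrite -[C]setCK; apply: measurableC; apply: open_measurable_rV.
  by rewrite openC.
have [F [cF ndF FT]] := open_compact_exhaustion (@openT 'rV[R]_d).
have mF n : measurable (F n : set (borelRV R d)).
  exact: compact_measurable_rV.
have mCc : (m C <= c)%E.
  have -> : C = \bigcup_n (C `&` F n) by rewrite -setI_bigcupr FT setIT.
  apply: measure_bigcup_le => [n|i j ij|n]; first exact: measurableI.
    by apply/subsetPset; apply: setIS; apply/subsetPset; exact: ndF.
  apply: Kc; first by rewrite setIC; exact: compact_closedI.
  by move=> x [/CA].
rewrite (measureDI m mA mC) addeC leeD//.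
  by rewrite setIC (setIidl CA).
apply: le_trans (ltW UCe); rewrite le_measure ?inE//.
- exact: measurableD.
- by apply: measurableD => //; exact: open_measurable_rV.
- exact: setSD.
Qed.

(** * Finite covers, disjoint families and slightly shrunk balls *)

Lemma measure_le_sum_cover d (T : measurableType d) (R : realType) (I : Type)
    (m : {measure set T -> \bar R}) (A : set T) (F : I -> set T) (s : seq I) :
  measurable A -> (forall i, measurable (F i)) ->
  A `<=` \big[setU/set0]_(i <- s) F i -> (m A <= \sum_(i <- s) m (F i))%E.
Proof.
move=> mA mF AF.
have mU (t : seq I) : measurable (\big[setU/set0]_(i <- t) F i).
  by apply: bigsetU_measurable => i _.
apply: (@le_trans _ _ (m (\big[setU/set0]_(i <- s) F i))).
  by rewrite le_measure ?inE.
elim: s {AF} => [|i s IH]; first by rewrite !big_nil measure0.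
by rewrite !big_cons; apply: le_trans (measureU2 m (mF i) (mU s)) _; rewrite leeD2l.
Qed.

Lemma measure_bigsetU_seq d (T : measurableType d) (R : realType)
    (I : choiceType) (m : {measure set T -> \bar R}) (F : I -> set T)
    (s : seq I) : uniq s -> (forall i, measurable (F i)) ->
  trivIset [set` s] F ->
  m (\big[setU/set0]_(i <- s) F i) = (\sum_(i <- s) m (F i))%E.
Proof.
move=> us mF tF; rewrite -bigcup_seq measure_fin_bigcup//.
by rewrite -fsbig_seq.
Qed.

Lemma trivIset_sub (I T : Type) (D : set I) (F G : I -> set T) :
  (forall i, F i `<=` G i) -> trivIset D G -> trivIset D F.
Proof.
move=> FG tG i j Di Dj [x [Fx Fy]]; apply: tG => //.
by exists x; split; exact: FG.
Qed.

(** An open ball is the union of its smaller concentric balls, so a slight shrinking loses little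
    mass. The family [B] is abstract to cover both cubes and Euclidean balls. *)
Lemma measure_inner_ball_lt d (T : measurableType d) (R : realType)
    (m : {measure set T -> \bar R}) (B : R -> set T) (r eta e : R) :
  (m (B r) < +oo)%E -> (forall s, measurable (B s)) ->
  (forall s t, s <= t -> B s `<=` B t) ->
  (forall x, B r x -> exists2 s, s < r & B s x) ->
  0 < eta -> 0 < e ->
  exists s, [/\ 0 < s, s < eta & (m (B r `\` B (r - s)%R) < e%:E)%E].
Proof.
(* The denominator starts at 2, so that [s n < eta] already for [n = 0]. *)
move=> mBr mB ndB Br eta0 e0; pose s n : R := eta / n.+2%:R.
have [|||||n nB] := @measure_nonincreasing_lt _ _ _ m
  (fun n => B r `\` B (r - s n)) e.
- by move=> n; exact: measurableD.
- move=> n k nk; apply/subsetPset; apply: setDS; apply: ndB.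
  by rewrite lerB// ler_pM2l// lef_pV2 ?posrE// ler_nat !ltnS.
- apply: le_lt_trans mBr; rewrite le_measure ?inE//; exact: measurableD.
- rewrite (_ : \bigcap_n _ = set0) ?measure0//.
  apply/seteqP; split => // x xB; have [/Br[t tr Btx] _] := xB 0%N I.
  pose n := Num.truncn (eta / (r - t)).
  have [_] := xB n I; apply; apply: ndB Btx.
  rewrite lerBrDr addrC -lerBrDr; apply: ltW; rewrite /s.
  rewrite ltr_pdivrMr// mulrC -ltr_pdivrMr ?subr_gt0//.
  by apply: lt_le_trans (truncnS_gt _) _; rewrite ler_nat.
- by [].
- exists (s n); split => //; first by rewrite divr_gt0.
  by rewrite ltr_pdivrMr// ltr_pMr// ltr1n.
Qed.

Lemma ball_inner (R : realType) (V : normedModType R) (x y : V) (r : R) :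
  ball x r y -> exists2 s, s < r & ball x s y.
Proof.
rewrite -ball_normE /= => xy; exists ((`|x - y| + r) / 2); first by lra.
by rewrite /ball_ /=; lra.
Qed.

(** * Superlevel sets of the maximal function *)

Lemma lebesgue_eball_fin (R : realType) (d : nat) (x : 'rV[R]_d) (r : R) :
  0 < r -> exists2 l, 0 < l & lebesgue_rV R d (eball x r) = l%:E.
Proof.
move=> r0; have := lebesgue_eball_le x r0; have := lebesgue_eball_ge x r0.
case: (lebesgue_rV R d (eball x r)) => [l| |]//; rewrite !lee_fin => l1 l2.
exists l => //; apply: lt_le_trans l1.
by rewrite exprn_gt0// pmulrn_lgt0// divr_gt0.
Qed.

Lemma lt_maximalP (R : realType) (d : nat)
    (mu : {charge set (borelRV R d) -> \bar R}) (x : 'rV[R]_d) (a : R) :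
  (a%:E < maximal mu x)%E <-> exists2 r, 0 < r &
    (a%:E * lebesgue_rV R d (eball x r) < `|mu (eball x r)|)%E.
Proof.
split=> [/ereal_sup_gt[_ [r /= + <-]]|[r r0 ar]].
  rewrite in_itv /= andbT => r0.
  have [l l0 lE] := lebesgue_eball_fin x r0.
  rewrite lE inver gt_eqF// lte_pdivlMr// => ar.
  by exists r => //; rewrite lE.
apply: (@lt_le_trans _ _ (`|mu (eball x r)| / lebesgue_rV R d (eball x r))%E).
  have [l l0 lE] := lebesgue_eball_fin x r0.
  by move: ar; rewrite lE inver gt_eqF// lte_pdivlMr.
by apply: ereal_sup_ubound; exists r => //=; rewrite in_itv /= r0.
Qed.

(** If [eball x r] is a witness at [x], then for [y] near [x] the ball [eball y (r - s / 2)] lies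
    between [eball x (r - s)] and [eball x r]. Its volume is no larger, and its charge differs by at
    most the variation of a thin shell, which is below the gap in the strict inequality. *)
Lemma open_superlevel (R : realType) (d : nat)
    (mu : {charge set (borelRV R d) -> \bar R}) (a : R) :
  0 <= a -> open [set x : 'rV[R]_d | (a%:E < maximal mu x)%E].
Proof.
move=> a0; rewrite openE => x /= /lt_maximalP[r r0].
have [P [N muPN]] := Hahn_decomposition mu.
pose V := charge_variation muPN.
have [l l0 lE] := lebesgue_eball_fin x r0; rewrite lE.
have : mu (eball x r) \is a fin_num by rewrite fin_num_measure//; exact: measurable_eball.
case muE : (mu (eball x r)) => [c| |]// _; rewrite /= lte_fin -subr_gt0 => e0.
have mB t : measurable (eball x t : set (borelRV R d)) by exact: measurable_eball.
have Vfin (A : set (borelRV R d)) : measurable A -> (V A < +oo)%E.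
  move=> mA; rewrite ltey_eq /V /charge_variation.
  by rewrite fin_numD !fin_num_measure.
have [|||s [s0 sr sV]] := @measure_inner_ball_lt _ _ _ V (eball x) r r _ _ mB _ _ r0 e0.
- exact: Vfin.
- move=> t u tu y; rewrite /eball /= => /lt_le_trans; exact.
- move=> y; rewrite /eball /= => yr; exists ((norm2 (y - x) + r) / 2); lra.
apply/nbhs_ballP; exists (s / 2 / d.+1%:R) => /=; first by rewrite !divr_gt0.
move=> y; rewrite -ball_normE /= => xy.
have dxy : d%:R * `|x - y| <= s / 2.
  apply: (@le_trans _ _ (d.+1%:R * `|x - y|)).
    by rewrite ler_wpM2r// ler_nat.
  by rewrite mulrC -ler_pdivlMr// ltW.
have r'0 : 0 < r - s / 2 by lra.
apply/lt_maximalP; exists (r - s / 2) => //.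
have BB : eball y (r - s / 2) `<=` eball x r.
  by apply: eball_sub_eball; lra.
have BB' : eball x (r - s) `<=` eball y (r - s / 2).
  by apply: eball_sub_eball; rewrite distrC; lra.
have mB' : measurable (eball y (r - s / 2) : set (borelRV R d)).
  exact: measurable_eball.
apply: (@le_lt_trans _ _ (a * l)%:E).
  by rewrite EFinM -lE lee_wpmul2l// le_measure ?inE.
have muD : (`|mu (eball x r)| <= V (eball x r `\` eball x (r - s)%R)
    + `|mu (eball y (r - s / 2)%R)|)%E.
  rewrite (chargeDI mu (mB r) mB') (setIidr BB).
  apply: le_trans (lee_abs_add _ _) _; rewrite leeD2r//.
  apply: le_trans (abse_charge_variation muPN (measurableD (mB r) mB')) _.
  rewrite le_measure ?inE//; [exact: measurableD|exact: measurableD|].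
  exact: setDS.
have [v vE] : exists v, V (eball x r `\` eball x (r - s)) = v%:E.
  exists (fine (V (eball x r `\` eball x (r - s)))).
  by rewrite fineK// ge0_fin_numE// Vfin//; exact: measurableD.
have {}sV : (v%:E < (`|c| - a * l)%:E)%E by rewrite -vE.
have : mu (eball y (r - s / 2)) \is a fin_num by rewrite fin_num_measure.
move: muD sV; rewrite muE vE; case: (mu _) => [c'| |]//.
rewrite /= -EFinD lee_fin !lte_fin; lra.
Qed.

(** * Weak-type estimate and the case of absolute continuity *)

Section weak_type.
Variables (R : realType) (d : nat) (mu : {charge set (borelRV R d) -> \bar R}).
Variables (P N : set (borelRV R d)) (muPN : hahn_decomposition mu P N).
Local Notation V := (charge_variation muPN).
Local Notation L := (lebesgue_rV R d).
Local Notation D := (d.+1%:R : R).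

(** Vitali is applied to the cubes, and [W] is the union of the Euclidean balls inside the disjoint
    cubes. The constant compares the tripled cube, of half side [3 * r], with a cube of half side
    [r / D] inside the Euclidean ball. *)
Lemma weak_type_compact (a : R) (K : set 'rV[R]_d) : 0 < a -> compact K ->
  K `<=` [set x | (a%:E < maximal mu x)%E] ->
  exists W : set (borelRV R d), [/\ measurable W, (a%:E * L W <= V W)%E &
    (L K <= ((3 * D) ^+ d)%:E * L W)%E].
Proof.
move=> a0 cK KE.
have H x : exists r, K x -> 0 < r /\ (a%:E * L (eball x r) < `|mu (eball x r)|)%E.
  have [Kx|Kx] := pselect (K x); last by exists 0.
  by have /lt_maximalP[r r0 ar] := KE x Kx; exists r.
have {H}[r H] := choice H.
have [|t [ut tK tt Kt]] := compact_vitali (r := r) cK.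
  by move=> x /H[].
have mB x : measurable (eball x (r x) : set (borelRV R d)).
  exact: measurable_eball.
have tB : trivIset [set` t] (fun x => eball x (r x)).
  apply: trivIset_sub tt => x; exact: eball_sub_ball.
exists (\big[setU/set0]_(x <- t) eball x (r x)); split.
- by apply: bigsetU_measurable => x _.
- rewrite !measure_bigsetU_seq// ge0_sume_distrr//.
  rewrite big_seq [leRHS]big_seq; apply: lee_sum => x xt.
  have [_ /ltW ar] := H x (tK x xt).
  exact: le_trans ar (abse_charge_variation muPN (mB x)).
- rewrite measure_bigsetU_seq// ge0_sume_distrr//.
  have m3 x : measurable (ball x (3 * r x) : set (borelRV R d)).
    exact: measurable_ballrV.
  apply: le_trans (measure_le_sum_cover L (compact_measurable_rV cK) m3 Kt) _.
  rewrite big_seq [leRHS]big_seq; apply: lee_sum => x xt.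
  have [r0 _] := H x (tK x xt).
  rewrite /= lebesgue_rV_cube ?mulr_gt0//.
  apply: (@le_trans _ _ (((3 * D) ^+ d)%:E * ((r x / D *+ 2) ^+ d)%:E)%E).
    rewrite -EFinM -exprMn lee_fin (_ : 3 * D * _ = 3 * r x *+ 2)//.
    by field; rewrite nat1r pnatr_eq0.
  by rewrite lee_wpmul2l ?lee_fin ?exprn_ge0 ?mulr_ge0// lebesgue_eball_ge.
Qed.

(** The bound [a * L W <= V W] is used twice: first with the total mass, to get [L W < del] and
    hence [V W < e / C], then with this smaller value of [V W]. *)
Lemma weak_type_limit (e : R) : mu `<< L -> 0 < e ->
  exists2 a0 : R, 0 < a0 & forall a, a0 < a ->
    (a%:E * L [set x : 'rV[R]_d | (a%:E < maximal mu x)%E] <= e%:E)%E.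
Proof.
move=> muL e0; pose C := (3 * D) ^+ d.
have C0 : 0 < C by rewrite exprn_gt0// mulr_gt0.
have [del [del0 Hdel]] := charge_variation_continuous muPN muL (divr_gt0 e0 C0).
have : V setT \is a fin_num by rewrite fin_num_measure.
case VT : (V setT) => [v| |]// _.
have v0 : 0 <= v by rewrite -lee_fin -VT measure_ge0.
(* Beyond this threshold [v / a < del]; the added 1 keeps it positive when [v = 0]. *)
exists ((v + 1) / del); first by rewrite divr_gt0// ltr_wpDl.
move=> a va; have a0 : 0 < a by apply: lt_trans va; rewrite divr_gt0// ltr_wpDl.
rewrite -lee_pdivlMl//; apply: measure_open_le_compact.
  by apply: open_superlevel; exact: ltW.
move=> K cK KE; have [W [mW aW KW]] := weak_type_compact a0 cK KE.
rewrite lee_pdivlMl//.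
have VW : (V W < (e / C)%:E)%E.
  apply: Hdel => //.
  apply: (@le_lt_trans _ _ (a^-1 * v)%:E).
    rewrite EFinM lee_pdivlMl// (le_trans aW)// -VT le_measure ?inE//.
  rewrite lte_fin mulrC ltr_pdivrMr//.
  by move: va; rewrite ltr_pdivrMr// mulrC; lra.
apply: (@le_trans _ _ (a%:E * (C%:E * L W))%E).
  by rewrite lee_wpmul2l// lee_fin ltW.
rewrite muleCA; apply: (@le_trans _ _ (C%:E * (e / C)%:E)%E).
  by rewrite lee_wpmul2l ?lee_fin ?(ltW C0)// (le_trans aW)// ltW.
by rewrite -EFinM mulrC divfK// gt_eqF.
Qed.

End weak_type.

(** * Growth iteration, escape radii and neighbourhoods of compact sets *)

(** Beyond [r0] the global bound [M] suffices. Below, a bound [2 * b * (q * s) ^+ d] at [q * s]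
    gives back [2 * b * s ^+ d] at [s], because [tau * q ^+ d] is one half; the induction is on the
    number of dilations by [q] needed to reach [r0]. *)
Lemma growth_iteration (R : realType) (d : nat) (f : R -> R)
    (M b q r0 tau rho : R) :
  2 <= q -> 0 <= b -> 0 <= tau -> 0 < rho -> 0 <= r0 ->
  tau * q ^+ d = 2^-1 -> (forall s, f s <= M) -> M <= 2 * b * r0 ^+ d ->
  (forall s, rho <= s -> s < r0 -> f s <= b * s ^+ d + tau * f (q * s)) ->
  forall s, rho <= s -> f s <= 2 * b * s ^+ d.
Proof.
move=> q2 b0 tau0 rho0 r00 tq fM Mb fs.
have large s : r0 <= s -> f s <= 2 * b * s ^+ d.
  move=> rs; rewrite (le_trans (fM s))// (le_trans Mb)// ler_wpM2l ?mulr_ge0//.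
  by rewrite lerXn2r// nnegrE (le_trans r00).
have H n s : rho <= s -> r0 <= q ^+ n * s -> f s <= 2 * b * s ^+ d.
  elim: n s => [|n IH] s rs; first by rewrite expr0 mul1r; exact: large.
  rewrite exprSr -mulrA => qs; have [|sr] := leP r0 s; first exact: large.
  have s0 : 0 < s by exact: lt_le_trans rs.
  have rqs : rho <= q * s by rewrite (le_trans rs)// ler_peMl ?ltW//; lra.
  apply: (le_trans (fs s rs sr)).
  have := ler_wpM2l tau0 (IH _ rqs qs); rewrite exprMn => h.
  have -> : 2 * b * s ^+ d = b * s ^+ d + tau * q ^+ d * (2 * b * s ^+ d).
    by rewrite tq; field.
  rewrite lerD2l; apply: (le_trans h); lra.
move=> s rs; have s0 : 0 < s by exact: lt_le_trans rs.
apply: (H (Num.truncn (r0 / s)).+1) => //.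
rewrite -ler_pdivrMr//; apply/ltW/(lt_le_trans (truncnS_gt _)).
apply: (@le_trans _ _ (2 ^+ (Num.truncn (r0 / s)).+1)).
  by rewrite -natrX ler_nat; exact/ltnW/ltn_expl.
by rewrite lerXn2r// nnegrE; lra.
Qed.

(** Among the cubes of radius [2 ^+ n * del], take the first one not inside [E]. Half its radius is
    [rho]: the previous cube lies in [E], or, if [n = 0], the cube of radius [del / 2] lies in
    [ball x del]. *)
Lemma escape_radius (R : realType) (d : nat) (E : set (borelRV R d))
    (x : 'rV[R]_d) (del : R) :
  measurable E -> (lebesgue_rV R d E < 1)%E -> 0 < del ->
  exists rho, [/\ 0 < rho, ball x rho `<=` E `|` ball x del &
    exists2 y, ball x (2 * rho) y & ~ E y].
Proof.
move=> mE E1 del0.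
have H n : ~ (ball x (2 ^+ n * del) `<=` E) -> exists rho,
    [/\ 0 < rho, ball x rho `<=` E `|` ball x del &
    exists2 y, ball x (2 * rho) y & ~ E y].
  elim: n => [|n IH].
    rewrite expr0 mul1r => /existsNP[y /not_implyP[xy Ey]].
    exists (del / 2); split; first by rewrite divr_gt0.
      by move=> z xz; right; apply: le_ball xz; lra.
    by exists y => //; rewrite mulrC divfK.
  have [xE|xE _] := pselect (ball x (2 ^+ n * del) `<=` E); last exact: IH.
  rewrite exprS -mulrA => /existsNP[y /not_implyP[xy Ey]].
  exists (2 ^+ n * del); split; first by rewrite mulr_gt0// exprn_gt0.
    by move=> z /xE; left.
  by exists y.
(* This exponent gives a radius of at least 1, hence a cube of measure at least 1, too large to lie
   in [E]. *)
apply: (H (Num.truncn del^-1).+1) => BE.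
pose r := 2 ^+ (Num.truncn del^-1).+1 * del; rewrite -/r in BE.
have r1 : 1 <= r.
  rewrite -ler_pdivrMr// div1r; apply/ltW/(lt_le_trans (truncnS_gt _)).
  by rewrite -natrX ler_nat; exact/ltnW/ltn_expl.
have : (1 <= lebesgue_rV R d E)%E.
  apply: (@le_trans _ _ (lebesgue_rV R d (ball x r))).
    rewrite lebesgue_rV_cube; last by lra.
    by rewrite lee_fin exprn_ege1//; lra.
  by rewrite le_measure ?inE//; exact: measurable_ballrV.
by rewrite leNgt E1.
Qed.

Lemma compact_neighborhood_lt (R : realType) (d : nat)
    (m : {measure set (borelRV R d) -> \bar R}) (K : set 'rV[R]_d) (e : R) :
  (forall x r, (m (ball x r) < +oo)%E) -> compact K -> m K = 0%E -> 0 < e ->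
  exists2 del, 0 < del & (m (\bigcup_(x in K) ball x del) < e%:E)%E.
Proof.
move=> mfin cK mK0 e0; pose U n := \bigcup_(x in K) ball x n.+1%:R^-1.
have oU n : open (U n) by apply: bigcup_open => x _; exact: ball_open.
have mU n : measurable (U n : set (borelRV R d)) by exact: open_measurable_rV.
have [|||||n nU] := @measure_nonincreasing_lt _ _ _ m U e.
- exact: mU.
- move=> n k nk; apply/subsetPset => y [x Kx xy]; exists x => //.
  by apply: le_ball xy; rewrite lef_pV2 ?posrE// ler_nat.
- have [M [Mreal HM]] := compact_bounded cK.
  (* [K] has norms at most [|M| + 1], a number above [M]; the last 1 is the radius of the first
     neighbourhood. *)
  apply: le_lt_trans (mfin 0 (`|M| + 1 + 1)).
  rewrite le_measure ?inE//; first exact: measurable_ballrV.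
  move=> y [x Kx xy]; rewrite -ball_normE /= sub0r normrN.
  rewrite -(subrK x y) (le_lt_trans (ler_normD _ _))// addrC ler_ltD//.
    by apply: (HM (`|M| + 1)) => //; rewrite ltr_pwDr// ler_norm.
  by move: xy; rewrite -ball_normE /= distrC invr1.
- rewrite (_ : \bigcap_n _ = K)//; apply/seteqP; split => [x Ux|x Kx n _].
    have clK : closed K by apply: compact_closed => //; exact: norm_hausdorff.
    apply: clK => B /nbhs_ballP[r /= r0 rB].
    have [y Ky yx] := Ux (Num.truncn r^-1) I.
    exists y; split => //; apply: rB; apply: ball_sym.
    apply: le_ball yx; apply: ltW; rewrite invf_plt ?posrE//.
    exact: truncnS_gt.
  by exists x => //; apply: ballxx; rewrite invr_gt0.
- by [].
- by exists n.+1%:R^-1.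
Qed.

(** * Vanishing of the singular part *)

Section singular_part.
Variables (R : realType) (d : nat).
Variables (p n : {finite_measure set (borelRV R d) -> \bar R}).
Local Notation L := (lebesgue_rV R d).
Local Notation D := d.+1%:R.

Let mball (x : 'rV[R]_d) r : measurable (ball x r : set (borelRV R d)).
Proof. exact: measurable_ballrV. Qed.

Let nfin (A : set (borelRV R d)) : measurable A -> (n A < +oo)%E.
Proof. by move=> mA; rewrite ltey_eq fin_num_measure. Qed.

(* Stands in for the Besicovitch differentiation theorem: with the dilated
   ball on the right-hand side, the Vitali covering lemma suffices. *)
Lemma compact_dominated_balls (K : set 'rV[R]_d) (tau : R) :
  compact K -> n K = 0%E -> (0 < p K)%E -> 0 < tau ->
  exists (K' : set 'rV[R]_d) (del : R), [/\ compact K', K' `<=` K,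
    (0 < p K')%E, 0 < del &
    forall x r, K' x -> 0 < r -> r < del ->
      (n (ball x r) <= tau%:E * p (ball x (6 * r)%R))%E].
Proof.
move=> cK nK0 pK0 tau0.
have mK := compact_measurable_rV cK.
have : p K \is a fin_num by rewrite fin_num_measure.
case pKE : (p K) => [c| |]// _; move: pK0; rewrite pKE lte_fin => c0.
have [|del del0 Udel] := compact_neighborhood_lt _ cK nK0 (mulr_gt0 tau0 c0).
  by move=> x r; exact: nfin.
pose U := \bigcup_(x in K) ball x del.
have oU : open U by apply: bigcup_open => x _; exact: ball_open.
have mU : measurable (U : set (borelRV R d)) by exact: open_measurable_rV.
(* The bad centres. They form an open set, by the same shrinking of balls as for superlevel sets, so
   removing them from [K] leaves a compact set. *)
pose A := [set x : 'rV[R]_d | exists r, [/\ 0 < r, r < del &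
  (tau%:E * p (ball x (6 * r)%R) < n (ball x r))%E]].
have oA : open A.
  rewrite openE => x [r [r0 rdel xr]].
  have : n (ball x r) \is a fin_num by rewrite fin_num_measure.
  case nE : (n (ball x r)) => [v| |]// _.
  have : p (ball x (6 * r)) \is a fin_num by rewrite fin_num_measure.
  case pE : (p (ball x (6 * r))) => [w| |]// _.
  move: xr; rewrite nE pE -EFinM lte_fin -subr_gt0 => vw.
  have [|||s [s0 sr sn]] := @measure_inner_ball_lt _ _ _ n (ball x) r r _ _ (mball x) _ _ r0 vw.
  - exact: nfin.
  - by move=> s t st; exact: le_ball.
  - by move=> y; exact: ball_inner.
  apply/nbhs_ballP; exists (s / 2) => /=; first by rewrite divr_gt0.
  move=> y xy; exists (r - s / 2); split; [lra|lra|].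
  have B1 : ball x (r - s) `<=` ball y (r - s / 2).
    move=> z xz; rewrite (_ : r - s / 2 = s / 2 + (r - s)); last by field.
    by apply: ball_triangle xz; exact: ball_sym.
  have B2 : ball y (6 * (r - s / 2)) `<=` ball x (6 * r).
    move=> z yz; have xz := ball_triangle xy yz.
    by apply: le_ball xz; lra.
  apply: (@le_lt_trans _ _ (tau * w)%:E).
    by rewrite EFinM -pE lee_wpmul2l ?lee_fin ?(ltW tau0)// le_measure ?inE.
  apply: (@lt_le_trans _ _ (n (ball x (r - s)))); last by rewrite le_measure ?inE.
  have B3 : ball x (r - s) `<=` ball x r by apply: le_ball; lra.
  have nv : n (ball x r) =
      (n (ball x r `\` ball x (r - s)%R) + n (ball x (r - s)%R))%E.
    by rewrite [LHS](measureDI n (mball x r) (mball x (r - s))) (setIidr B3).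
  rewrite nE in nv.
  have [u uE] : exists u, n (ball x r `\` ball x (r - s)) = u%:E.
    exists (fine (n (ball x r `\` ball x (r - s)))).
    by rewrite fineK// fin_num_measure//; exact: measurableD.
  have {}sn : (u%:E < (v - tau * w)%:E)%E by rewrite -uE.
  have : n (ball x (r - s)) \is a fin_num by rewrite fin_num_measure.
  move: nv sn; rewrite uE; case: (n _) => [u'| |]//.
  by rewrite -EFinD => -[->] /=; rewrite !lte_fin; lra.
have mA : measurable (A : set (borelRV R d)) by exact: open_measurable_rV.
(* Vitali on the bad points: the tripled balls have [p]-mass at most [tau^-1] times the [n]-mass of
   the disjoint balls, all inside [U]. As [n U < tau * c], the bad points cannot carry all of
   [p K]. *)
have pA : (p (K `&` A) <= (tau^-1)%:E * n U)%E.
  apply: finite_measure_le_compact; first exact: measurableI.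
  move=> K2 cK2 K2A.
  have H x : exists r, K2 x -> [/\ 0 < r, r < del &
      (tau%:E * p (ball x (6 * r)%R) < n (ball x r))%E].
    have [Kx|Kx] := pselect (K2 x); last by exists 0.
    by have [_ [r rP]] := K2A x Kx; exists r.
  have {H}[r H] := choice H.
  have [|t [ut tK tt Kt]] := compact_vitali (r := r) cK2.
    by move=> x /H[].
  have mK2 := compact_measurable_rV cK2.
  apply: le_trans (measure_le_sum_cover p mK2 (fun x => mball x (3 * r x)) Kt) _.
  apply: (@le_trans _ _ (\sum_(x <- t) ((tau^-1)%:E * n (ball x (r x))))%E).
    rewrite big_seq [leRHS]big_seq; apply: lee_sum => x xt.
    have [r0 _ /ltW xr] := H x (tK x xt).
    rewrite lee_pdivlMl//; apply: le_trans xr.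
    rewrite lee_wpmul2l ?lee_fin ?(ltW tau0)// le_measure ?inE//.
    by apply: le_ball; rewrite ler_pM2r//; lra.
  rewrite -ge0_sume_distrr// lee_wpmul2l ?lee_fin ?invr_ge0 ?(ltW tau0)//.
  rewrite -measure_bigsetU_seq// le_measure ?inE//.
    by apply: bigsetU_measurable => x _.
  rewrite -bigcup_seq => y [x xt xy]; exists x.
    by have [] := K2A x (tK x xt).
  have [_ rdel _] := H x (tK x xt).
  exact: le_ball (ltW rdel) _ xy.
exists (K `&` ~` A), del; split => //.
- by apply: compact_closedI => //; rewrite closedC.
- rewrite -setDE lt_neqAle measure_ge0 andbT eq_sym; apply/eqP => p0.
  have pc : p K = (p (K `\` A) + p (K `&` A))%E := measureDI p mK mA.
  rewrite p0 add0e pKE in pc.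
  move: pA; rewrite -pc leNgt lte_pdivrMl// -EFinM => /negP; exact.
- move=> x r [_ Ax] r0 rdel; rewrite leNgt; apply/negP => xr; apply: Ax.
  by exists r.
Qed.

(** All that is kept of the maximal function, with [E] as its superlevel set. In terms of [p] and
    [n] it is available for the Jordan parts in both orders. *)
Hypothesis pn : forall e b : R, 0 < e -> exists (a : R) (E : set (borelRV R d)),
  [/\ b < a, measurable E, (a%:E * L E < e%:E)%E &
   forall y r, ~ E y -> 0 < r ->
     (p (eball y r) <= a%:E * L (eball y r) + n (eball y r))%E].

(** [30] is [6 * 5]: moving to a centre outside [E] and back enlarges the radius by [5 * D], and the
    domination of [n] by [p] by 6. Then [tau * q ^+ d] is one half. *)
Let q : R := 30 * D.
Let tau : R := (2 * q ^+ d)^-1.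

Lemma compact_mass_bound (K : set 'rV[R]_d) (del e : R) :
  compact K -> L K = 0%E -> 0 < del ->
  (forall x r, K x -> 0 < r -> r < del ->
      (n (ball x r) <= tau%:E * p (ball x (6 * r)%R))%E) ->
  0 < e -> e <= 1 -> (p K <= (4 * (9 * D) ^+ d * e)%:E)%E.
Proof.
move=> cK LK0 del0 nK e0 e1.
have D1 : 1 <= D :> R by rewrite ler1n.
(* For [s < r0] the radius [5 * D * s] stays below [del], where [nK] applies. *)
pose r0 := del / (5 * D).
have r00 : 0 < r0 by rewrite divr_gt0// mulr_gt0//; lra.
have q0 : 0 < q by rewrite mulr_gt0//; lra.
have tau0 : 0 < tau by rewrite invr_gt0 mulr_gt0// exprn_gt0.
pose M := fine (p setT).
have fM (A : set (borelRV R d)) : measurable A -> fine (p A) <= M.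
  move=> mA; rewrite fine_le ?fin_num_measure// le_measure ?inE//.
have M0 : 0 <= M by rewrite fine_ge0.
(* The 1 gives [L E < 1], as [escape_radius] demands; the other term makes the growth bound hold
   trivially for radii above [r0]. *)
have [a [E [ba mE aE pE]]] := pn (1 + M / r0 ^+ d) e0.
have Mr0 : 0 <= M / r0 ^+ d by rewrite divr_ge0// exprn_ge0// ltW.
have a1 : 1 < a by lra.
have a0 : 0 < a by lra.
have E1 : (L E < 1)%E.
  rewrite -(@lte_pmul2l _ a%:E) ?lte_fin// mule1.
  by apply: lt_trans aE _; rewrite lte_fin; lra.
have [|U0 U00 LU] := compact_neighborhood_lt _ cK LK0 (divr_gt0 e0 a0).
- move=> x r; have [r1|r1] := ltP 0 r.
    by rewrite /= lebesgue_rV_cube// ltry.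
  rewrite (_ : ball x r = set0) ?measure0//; apply/seteqP; split => // y.
  by rewrite -ball_normE /= => /(le_lt_trans (normr_ge0 _)); rewrite ltNge r1.
set U := \bigcup_(x in K) ball x U0 in LU.
have oU : open U by apply: bigcup_open => x _; exact: ball_open.
have mU : measurable (U : set (borelRV R d)) by exact: open_measurable_rV.
have [rho Hrho] := choice (fun x => escape_radius x mE E1 U00).
have C6 : 1 <= (6 * D) ^+ d :> R by rewrite exprn_ege1//; lra.
have bound x : K x -> (p (ball x (rho x)) <=
    (2 * (a * (6 * D) ^+ d) * (rho x) ^+ d)%:E)%E.
  move=> Kx; have [rho0 _ [y xy Ey]] := Hrho x.
  pose f s := fine (p (ball x s)).
  have pf s : p (ball x s) = (f s)%:E by rewrite fineK// fin_num_measure.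
  rewrite pf lee_fin.
  apply: (@growth_iteration _ d f M _ q r0 tau (rho x)) => //.
  - rewrite /q; lra.
  - by rewrite mulr_ge0 ?(ltW a0)//; lra.
  - exact: ltW.
  - exact: ltW.
  - by rewrite /tau; field; rewrite gt_eqF// exprn_gt0.
  - by move=> s; exact: fM.
  - rewrite -ler_pdivrMr ?exprn_gt0//; apply: (@le_trans _ _ a); first lra.
    by rewrite mulrCA ler_peMr ?(ltW a0)//; lra.
  - move=> s rs sr0; have s0 : 0 < s by exact: lt_le_trans rs.
    have Ds : s <= D * s by rewrite ler_peMl// ltW.
    have Ds0 : 0 < 3 * D * s by rewrite !mulr_gt0//; lra.
    (* The point [y] outside [E] is within [2 * rho x <= 2 * s] of [x]: passing to centre [y] costs
       radius [3 * s], the Euclidean ball a factor [D], and the return to [x] at most [2 * D * s]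
       more. *)
    have B1 : ball x s `<=` eball y (3 * D * s).
      apply: (@subset_trans _ (ball y (3 * s))).
        move=> z xz; rewrite (_ : 3 * s = 2 * s + s); last by ring.
        apply: ball_triangle xz; apply: ball_sym; apply: le_ball xy; lra.
      apply: ball_sub_eball; rewrite subrr [norm2 _](_ : _ = 0); last first.
        by rewrite /norm2 big1 ?sqrtr0// => i _; rewrite mxE expr0n.
      lra.
    have B2 : eball y (3 * D * s) `<=` ball x (5 * D * s).
      apply: (subset_trans (@eball_sub_ball _ _ _ _)) => z yz.
      have xz := ball_triangle xy yz; apply: le_ball xz; lra.
    rewrite -lee_fin EFinD -pf.
    have mB' := @measurable_eball R d y (3 * D * s).
    apply: (@le_trans _ _ (p (eball y (3 * D * s)))).
      by rewrite le_measure ?inE.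
    apply: le_trans (pE _ _ Ey Ds0) _; apply: leeD.
      apply: (@le_trans _ _ (a%:E * ((3 * D * s *+ 2) ^+ d)%:E)%E).
        by rewrite lee_wpmul2l ?lee_fin ?(ltW a0)// lebesgue_eball_le.
      rewrite -EFinM lee_fin (_ : 3 * D * s *+ 2 = 6 * D * s); last by ring.
      by rewrite exprMn mulrA.
    apply: (@le_trans _ _ (n (ball x (5 * D * s)))).
      by rewrite le_measure ?inE.
    have qs : q * s = 6 * (5 * D * s) by rewrite /q; ring.
    rewrite EFinM -pf qs; apply: nK => //; first by rewrite !mulr_gt0//; lra.
    by move: sr0; rewrite ltr_pdivlMr 1?mulrC// mulr_gt0//; lra.
(* With radii [rho x / 3], the tripled cubes are those of [bound], and the disjoint ones lie in the
   union of [E] and [U]. *)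
have [|t [ut tK tt Kt]] := compact_vitali (r := fun x => rho x / 3) cK.
  by move=> x _; have [rho0 _ _] := Hrho x; rewrite divr_gt0.
have mK := compact_measurable_rV cK.
apply: le_trans (measure_le_sum_cover p mK (fun x => mball x (3 * (rho x / 3))) Kt) _.
(* The 9 comes from [6 * D * rho x = 9 * D * (rho x / 3 *+ 2)], whose last factor is the side of the
   small cube. *)
pose C : R := 2 * (9 * D) ^+ d.
have C0 : 0 <= C by rewrite mulr_ge0// exprn_ge0//; lra.
apply: (@le_trans _ _ (\sum_(x <- t) (C * a)%:E * L (ball x (rho x / 3)))%E).
  rewrite big_seq [leRHS]big_seq; apply: lee_sum => x xt.
  have [rho0 _ _] := Hrho x.
  rewrite /= lebesgue_rV_cube ?divr_gt0//.
  rewrite (_ : 3 * (rho x / 3) = rho x); last by field.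
  apply: le_trans (bound x (tK x xt)) _; rewrite -EFinM lee_fin /C.
  rewrite (_ : 2 * (a * (6 * D) ^+ d) * rho x ^+ d = 2 * a * (6 * D * rho x) ^+ d).
    rewrite (_ : 6 * D * rho x = 9 * D * (rho x / 3 *+ 2)).
      by rewrite [in leLHS]exprMn; lra.
    by field.
  by rewrite [in RHS]exprMn; ring.
rewrite -ge0_sume_distrr// -measure_bigsetU_seq//.
apply: (@le_trans _ _ ((C * a)%:E * (L E + L U))%E).
  rewrite lee_wpmul2l ?lee_fin ?mulr_ge0 ?(ltW a0)//.
  apply: le_trans (measureU2 L mE mU); rewrite le_measure ?inE//.
  - by apply: bigsetU_measurable => x _.
  - exact: measurableU.
  - rewrite -bigcup_seq => y [x xt xy].
    have [rho0 EU _] := Hrho x.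
    have [|Ey|Uy] := EU y; first by apply: le_ball xy; lra.
      by left.
    by right; exists x => //; exact: tK.
rewrite EFinM -muleA ge0_muleDr// (_ : 4 * _ * e = C * (e + e)); last first.
  by rewrite /C; ring.
rewrite [leRHS]EFinM lee_wpmul2l ?lee_fin// EFinD leeD//; first exact: ltW.
by rewrite -lee_pdivlMl// -EFinM mulrC ltW.
Qed.

Lemma singular_part_eq0 (A : set (borelRV R d)) :
  measurable A -> L A = 0%E -> n A = 0%E -> p A = 0%E.
Proof.
have D1 : 1 <= D :> R by rewrite ler1n.
move=> mA LA nA; apply/eqP; rewrite eq_le measure_ge0 andbT.
apply: finite_measure_le_compact => // K cK KA.
have mK := compact_measurable_rV cK.
have LK : L K = 0%E.
  by apply/eqP; rewrite eq_le measure_ge0 andbT -LA le_measure ?inE.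
have nK : n K = 0%E.
  by apply/eqP; rewrite eq_le measure_ge0 andbT -nA le_measure ?inE.
rewrite leNgt; apply/negP => pK.
have tau0 : 0 < tau.
  by rewrite invr_gt0 mulr_gt0// exprn_gt0// mulr_gt0//; lra.
have [K' [del [cK' K'K pK' del0 nK']]] := compact_dominated_balls cK nK pK tau0.
have mK' := compact_measurable_rV cK'.
have LK' : L K' = 0%E.
  by apply/eqP; rewrite eq_le measure_ge0 andbT -LK le_measure ?inE.
have : p K' \is a fin_num by rewrite fin_num_measure.
case pE : (p K') => [c| |]// _; move: pK'; rewrite pE lte_fin => c0.
pose C : R := 4 * (9 * D) ^+ d.
have C1 : 1 <= C.
  have : 1 <= (9 * D) ^+ d :> R by rewrite exprn_ege1//; lra.
  rewrite /C; lra.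
(* This choice turns the mass bound into [c <= c / 2], contradicting [0 < c]. *)
pose e := Num.min 1 (c / (2 * C)).
have e0 : 0 < e by rewrite lt_min ltr01 divr_gt0// mulr_gt0//; lra.
have e1 : e <= 1 by rewrite ge_min lexx.
have := compact_mass_bound cK' LK' del0 nK' e0 e1; rewrite pE lee_fin -/C.
have : C * e <= C * (c / (2 * C)).
  by rewrite ler_wpM2l ?ge_min ?lexx ?orbT//; lra.
rewrite (_ : C * (c / (2 * C)) = c / 2); last by field; lra.
lra.
Qed.

End singular_part.

(** * The lower limit and the two implications *)

Lemma limf_einf_pinfty_eq0 (R : realType) (g : R -> \bar R) :
  (forall a, 0 < a -> (0 <= g a)%E) ->
  limf_einf g (pinfty_nbhs R) = 0%E <->
  forall e b : R, 0 < e -> exists2 a, b < a & (g a < e%:E)%E.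
Proof.
move=> g0; rewrite limf_einfE; split => [g_eq0 e b e0|H].
  have : (ereal_inf (g @` [set a | (b < a)%R]) < e%:E)%E.
    apply: (@le_lt_trans _ _ 0%E); last by rewrite lte_fin.
    rewrite -g_eq0; apply: ereal_sup_ubound; exists [set a | (b < a)%R] => //.
    by exists b; split; first exact: num_real.
  by move=> /ereal_inf_lt[_ [a /= ba <-] ae]; exists a.
apply/eqP; rewrite eq_le; apply/andP; split.
  apply: ge_ereal_sup => _ [V [M [_ MV]] <-]; apply/lee_addgt0Pr => e e0.
  have [a Ma ae] := H e M e0; rewrite add0e (le_trans _ (ltW ae))//.
  by apply: ereal_inf_lbound; exists a => //; exact: MV.
apply: (@le_trans _ _ (ereal_inf (g @` [set a | 0 < a]))).
  by apply: le_ereal_inf_tmp => _ [a /= a0 <-]; exact: g0.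
apply: ereal_sup_ubound; exists [set a | 0 < a] => //.
by exists 0; split; first exact: num_real.
Qed.

(** Outside the superlevel set the two Jordan parts differ by at most [a%:E * L] on each ball; both
    inequalities are recorded since each part plays the role of [p] in turn. *)
Lemma jordan_maximal_le (R : realType) (d : nat)
    (mu : {charge set (borelRV R d) -> \bar R}) (P N : set (borelRV R d))
    (muPN : hahn_decomposition mu P N) (a r : R) (y : 'rV[R]_d) :
  ~ (a%:E < maximal mu y)%E -> 0 < r ->
  let L := lebesgue_rV R d (eball y r) in
  (jordan_pos muPN (eball y r) <= a%:E * L + jordan_neg muPN (eball y r))%E /\
  (jordan_neg muPN (eball y r) <= a%:E * L + jordan_pos muPN (eball y r))%E.
Proof.
move=> aE r0 L; have mB := @measurable_eball R d y r.
have : (`|mu (eball y r)| <= a%:E * L)%E.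
  by rewrite leNgt; apply/negP => h; apply: aE; apply/lt_maximalP; exists r.
have -> : mu (eball y r) =
    (jordan_pos muPN (eball y r) - jordan_neg muPN (eball y r))%E.
  by rewrite (jordan_decomp muPN mB) /cadd /= cscaleN1.
have [l l0 LE] := lebesgue_eball_fin y r0; rewrite /L LE.
have : jordan_pos muPN (eball y r) \is a fin_num by rewrite fin_num_measure.
have : jordan_neg muPN (eball y r) \is a fin_num by rewrite fin_num_measure.
case: (jordan_pos _ _) => [p| |]//; case: (jordan_neg _ _) => [n| |]// _ _.
rewrite /= -!EFinM -!EFinD !lee_fin ler_norml => /andP[? ?]; split; lra.
Qed.

Unset Implicit Arguments.

(* A charge is a finite signed measure. The superlevel set
   {x | maximal mu x > lambda} is open, as B(x, r) is an open ball. *)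
Theorem mainTheorem3 (R : realType) (d : nat)
    (mu : {charge set (borelRV R d) -> \bar R}) :
  mu `<< lebesgue_rV R d <->
  limf_einf (fun lambda : R => (lambda%:E *
      lebesgue_rV R d [set x : 'rV[R]_d | lambda%:E < maximal mu x])%E)
    (pinfty_nbhs R) = 0%E.
Proof.
have [P [N muPN]] := Hahn_decomposition mu.
rewrite limf_einf_pinfty_eq0; last first.
  by move=> a a0; rewrite mule_ge0// lee_fin ltW.
split=> [muL e b e0|H].
  have e20 : 0 < e / 2 by rewrite divr_gt0.
  have [a0 a00 Ha] := weak_type_limit muPN muL e20.
  exists (Num.max a0 b + 1); first by rewrite ltr_pwDr// le_max lexx orbT.
  apply: le_lt_trans (Ha _ _) _; last by rewrite lte_fin; lra.
  by rewrite ltr_pwDr// le_max lexx.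
(* The level is taken above 0 as well as above [b], so that the superlevel set is open and hence
   measurable. *)
have HE (e b : R) : 0 < e -> exists (a : R) (E : set (borelRV R d)),
  [/\ b < a, measurable E, (a%:E * lebesgue_rV R d E < e%:E)%E &
    forall y, ~ E y -> ~ (a%:E < maximal mu y)%E].
  move=> e0; have [a ba ae] := H e (Num.max b 0) e0.
  move: ba; rewrite gt_max => /andP[ba a0].
  exists a, [set x | (a%:E < maximal mu x)%E]; split => //.
  by apply: open_measurable_rV; apply: open_superlevel; exact: ltW.
have mP : measurable P by case: muPN => -[].
have mN : measurable N by case: muPN => _ [].
have PN0 : P `&` N = set0 by case: muPN.
have posE (A : set (borelRV R d)) : measurable A ->
    jordan_pos muPN A = mu (A `&` P).
  by move=> mA; rewrite jordan_posE cjordan_posE /crestr0 mem_set.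
have negE (A : set (borelRV R d)) : measurable A ->
    jordan_neg muPN A = (- mu (A `&` N))%E.
  by move=> mA; rewrite jordan_negE cjordan_negE /crestr0 mem_set.
apply/null_content_dominatesP => A mA LA0.
have mAP : measurable (A `&` P) by exact: measurableI.
have mAN : measurable (A `&` N) by exact: measurableI.
have null (B : set (borelRV R d)) : measurable B -> B `<=` A ->
    lebesgue_rV R d B = 0%E.
  by move=> mB BA; apply/eqP; rewrite eq_le measure_ge0 andbT -LA0 le_measure ?inE.
(* On [A] intersected with [P] the negative part vanishes, so the positive part is the [p] of the
   singular argument; the roles are exchanged on [N]. *)
have muP : mu (A `&` P) = 0%E.
  have <- : jordan_pos muPN (A `&` P) = mu (A `&` P).
    by rewrite posE// -setIA setIid.
  apply: (@singular_part_eq0 R d (jordan_pos muPN) (jordan_neg muPN)) => //.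
  - move=> e b e0; have [a [E [ba mE aE yE]]] := HE e b e0.
    exists a, E; split => // y r Ey r0.
    by have [] := jordan_maximal_le muPN (yE y Ey) r0.
  - by apply: null => // x [].
  - have := negE _ mAP; rewrite -setIA PN0 setI0 charge0 oppe0; exact.
have muN : mu (A `&` N) = 0%E.
  apply/eqP; rewrite -oppe_eq0; apply/eqP.
  have <- : jordan_neg muPN (A `&` N) = (- mu (A `&` N))%E.
    by rewrite negE// -setIA setIid.
  apply: (@singular_part_eq0 R d (jordan_neg muPN) (jordan_pos muPN)) => //.
  - move=> e b e0; have [a [E [ba mE aE yE]]] := HE e b e0.
    exists a, E; split => // y r Ey r0.
    by have [] := jordan_maximal_le muPN (yE y Ey) r0.
  - by apply: null => // x [].
  - have := posE _ mAN; rewrite -setIA (setIC N) PN0 setI0 charge0; exact.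
have [_ _ PNT _] := muPN.
by rewrite -[A]setIT -PNT setIUr chargeU// ?muP ?muN ?adde0// setIACA PN0 setI0.
Qed.
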